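(* The disjoint union of finitely many spectrally threshold dominated graphs is spectrally threshold dominated, and the complement of a spectrally threshold dominated graph is spectrally threshold dominated.
   Context: All graphs are finite and simple. For a graph $G$ on $n$ nodes, the Laplacian eigenvalues (eigenvalues of $L(G)=D(G)-A(G)$) are $\lambda_1(G)\ge\dots\ge\lambda_n(G)=0$. A threshold graph is a graph obtainable from the empty graph by repeatedly adding a new node that is either isolated or adjacent to all previously added nodes. A graph $G$ on $n$ nodes with $m$ edges is spectrally threshold dominated if for each $k\in\{1,\dots,n\}$ there is a threshold graph $T_k$ on $n$ nodes with $m$ edges satisfying $\sum_{i=1}^k\lambda_i(T_k)\ge\sum_{i=1}^k\lambda_i(G)$. *)

(* Defs.v *)
From HB Require Import structures.
From mathcomp Require Import all_boot all_order all_algebra.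
From mathcomp Require Import reals.
Set Implicit Arguments. Unset Strict Implicit. Unset Printing Implicit Defensive.
Import Order.TTheory GRing.Theory Num.Theory.
Local Open Scope ring_scope.

Definition simple_graph (V : finType) (e : rel V) : Prop :=
  irreflexive e /\ symmetric e.

Definition num_edges (V : finType) (e : rel V) : nat :=
  #|[set E : {set V} | (#|E| == 2)%N &&
      [forall x in E, forall y in E, (x != y) ==> e x y]]|.

Definition degree (V : finType) (e : rel V) (x : V) : nat := #|[set y | e x y]|.

Definition laplacian (R : realType) (V : finType) (e : rel V) : 'M[R]_#|V| :=
  \matrix_(i, j)
    ((if i == j then (degree e (enum_val i))%:R else 0)
     - (e (enum_val i) (enum_val j))%:R).

Arguments laplacian R [V] e.
Definition lap_spectrum (R : realType) (V : finType) (e : rel V) (s : seq R) : Prop :=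
  [/\ size s = #|V|, sorted >=%R s &
      char_poly (laplacian R e) = \prod_(x <- s) ('X - x%:P)].

Definition top_sum (R : realType) (s : seq R) (k : nat) : R :=
  \sum_(i < k) s`_i.

(* Threshold graph: there is an order of insertion of the nodes (an injective
   [ord : V -> nat]) and, for each step, a choice [b] of "dominating"
   (adjacent to all previously added nodes) or "isolated"; two distinct nodes
   are adjacent iff the later-added one was added as dominating. *)
Definition threshold (V : finType) (e : rel V) : Prop :=
  exists (ord : V -> nat) (b : nat -> bool),
    injective ord /\
    forall x y, e x y = (x != y) && b (maxn (ord x) (ord y)).

Definition spec_thr_dominated (R : realType) (V : finType) (e : rel V) : Prop :=
  forall k : nat, (1 <= k <= #|V|)%N ->
    forall sG, @lap_spectrum R V e sG ->
    exists T : rel V,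
      [/\ threshold T, num_edges T = num_edges e &
          exists sT, @lap_spectrum R V T sT /\ top_sum sG k <= top_sum sT k].

Definition disjoint_union (I : finType) (V : I -> finType)
    (e : forall i, rel (V i)) : rel {i : I & V i} :=
  fun x y => (tag x == tag y) && e (tag x) (tagged x) (tagged_as x y).

Definition complement (V : finType) (e : rel V) : rel V :=
  fun x y => (x != y) && ~~ e x y.

(* Main.v *)
Require Import Defs.
From HB Require Import structures.
From mathcomp Require Import all_boot all_order all_fingroup all_algebra.
From mathcomp Require Import reals boolp.
From mathcomp Require Import zify ring lra.
Set Implicit Arguments. Unset Strict Implicit. Unset Printing Implicit Defensive.
Import Order.TTheory GRing.Theory Num.Theory.
Local Open Scope ring_scope.

(* Write S_k for the sum of the k largest Laplacian eigenvalues.  The maximum of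
   S_k over the threshold graphs with n nodes and m edges is
     min (2 m, m + k (k + 1) / 2, k n),
   so that spectral threshold dominance amounts to Brouwer's inequality
   S_k <= m + k (k + 1) / 2 together with the two trivial bounds.  These three
   bounds are stable under disjoint unions, because sum_i k_i (k_i + 1) <=
   k (k + 1) when k = sum_i k_i, and under complements, because the spectrum of
   the complement consists of one 0 and the n - lambda for the other eigenvalues
   lambda.  A threshold graph is built by adding isolated nodes and taking
   complements, hence it satisfies the bounds too.  That the minimum is attained
   is shown by induction on n: for 0 < k < n - 1, either an isolated node can be
   removed, or it can after passing to the complement, which exchanges (m, k)
   with (n (n - 1) / 2 - m, n - 1 - k). *)

(** * Graphs *)

(** Double counting: the ordered adjacent pairs are grouped by their underlying two-element set, and
    each edge comes from exactly two pairs. All later edge counts go through degrees. *)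
Lemma sum_degree (V : finType) (e : rel V) : simple_graph e ->
  (\sum_x degree e x)%N = (2 * num_edges e)%N.
Proof.
case=> eirr sym_e.
under eq_bigr => x _ do rewrite /degree -sum1dep_card.
rewrite (pair_big_dep xpredT (fun x y => e x y)) /=.
rewrite (partition_big (fun p : V * V => [set p.1; p.2])
   (fun E => (#|E| == 2)%N && [forall x in E, forall y in E, (x != y) ==> e x y])) /=; last first.
  case=> x y /= exy; have nxy : x != y by apply: contraTneq exy => ->; rewrite eirr.
  rewrite cards2 nxy /=; apply/forall_inP => a; rewrite !inE => /orP[]/eqP->;
  by apply/forall_inP => b; rewrite !inE => /orP[]/eqP->; rewrite ?eqxx //= ?nxy //
    1?sym_e ?exy ?implybT.
rewrite (eq_bigr (fun=> 2%N)); last first.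
  move=> E /andP[/cards2P[x [y [nxy ->]]] /forall_inP ed].
  have exy : e x y.
    by have /forall_inP/(_ y) := ed x (set21 x y); rewrite set22 nxy; apply.
  rewrite sum1dep_card.
  rewrite (_ : [set _ | _] = [set (x, y); (y, x)]) ?cards2 ?xpair_eqE ?(negPf nxy) //.
  apply/setP => -[a b]; rewrite !inE !xpair_eqE /=.
  apply/andP/orP => [[eab /eqP/setP eqE]|[]/andP[/eqP-> /eqP->]]; last first.
  - by rewrite sym_e exy setUC eqxx.
  - by rewrite exy eqxx.
  have nab : a != b by apply: contraTneq eab => ->; rewrite eirr.
  move: (eqE a) (eqE b) nab; rewrite !inE !eqxx orbT /=.
  by move=> /esym/orP[]/eqP-> /esym/orP[]/eqP->; rewrite ?eqxx; auto.
by rewrite sum_nat_const mulnC /num_edges cardsE.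
Qed.

Lemma inj_surj_bij (V W : finType) (f : W -> V) :
  injective f -> (forall v, exists w, f w = v) -> bijective f.
Proof.
move=> finj fsurj; apply: inj_card_bij => //.
rewrite -(card_codom finj); apply/subset_leq_card/subsetP => v _.
by have [w <-] := fsurj v; exact: codom_f.
Qed.

Lemma eq_card_bij (V W : finType) : #|V| = #|W| -> exists f : V -> W, bijective f.
Proof.
move=> eVW; exists (fun v => enum_val (cast_ord eVW (enum_rank v))).
exists (fun w => enum_val (cast_ord (esym eVW) (enum_rank w))) => x.
  by rewrite enum_valK cast_ordK enum_rankK.
by rewrite enum_valK cast_ordKV enum_rankK.
Qed.

Lemma simple_relpre (V W : finType) (e : rel V) (f : W -> V) :
  simple_graph e -> simple_graph (relpre f e).
Proof. by case=> ei es; split=> [x|x y] /=; rewrite ?ei // es. Qed.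

Lemma num_edges_relpre (V W : finType) (e : rel V) (f : W -> V) :
  simple_graph e -> bijective f -> num_edges (relpre f e) = num_edges e.
Proof.
move=> se bf; suff: (2 * num_edges (relpre f e) = 2 * num_edges e)%N by lia.
rewrite -!sum_degree //; last exact: simple_relpre.
rewrite [RHS](reindex f (onW_bij _ bf)); apply: eq_bigr => x _.
rewrite /degree -[RHS](on_card_preimset (onW_bij _ bf)).
by apply: eq_card => y; rewrite !inE.
Qed.

Definition sum_rel (V W : finType) (e : rel V) (f : rel W) : rel (V + W) :=
  fun x y => match x, y with
             | inl a, inl b => e a b
             | inr a, inr b => f a b
             | _, _ => false
             end.

Lemma degree_sum_inl (V W : finType) (e : rel V) (f : rel W) a :
  degree (sum_rel e f) (inl a) = degree e a.
Proof.
rewrite /degree -(card_imset _ (@inl_inj V W)); apply: eq_card => -[y|y]; rewrite !inE /=.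
  by rewrite mem_imset ?inE //; exact: inl_inj.
by symmetry; apply/imsetP => -[].
Qed.

Lemma degree_sum_inr (V W : finType) (e : rel V) (f : rel W) a :
  degree (sum_rel e f) (inr a) = degree f a.
Proof.
rewrite /degree -(card_imset _ (@inr_inj V W)); apply: eq_card => -[y|y]; rewrite !inE /=.
  by symmetry; apply/imsetP => -[].
by rewrite mem_imset ?inE //; exact: inr_inj.
Qed.

Definition add_isolated (V : finType) (e : rel V) : rel (V + unit) :=
  sum_rel e (fun _ _ => false).

Lemma simple_add_isolated (V : finType) (e : rel V) :
  simple_graph e -> simple_graph (add_isolated e).
Proof. by case=> ei es; split=> [[x|x]|[x|x] [y|y]] /=. Qed.

Lemma num_edges_add_isolated (V : finType) (e : rel V) :
  simple_graph e -> num_edges (add_isolated e) = num_edges e.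
Proof.
move=> se; suff: (2 * num_edges (add_isolated e) = 2 * num_edges e)%N by lia.
rewrite -!sum_degree //; last exact: simple_add_isolated.
rewrite big_sumType /= [X in (_ + X)%N]big1 ?addn0 => [|x _].
  by apply: eq_bigr => x _; rewrite degree_sum_inl.
by rewrite degree_sum_inr; apply: eq_card0 => y; rewrite inE.
Qed.

Lemma simple_complement (V : finType) (e : rel V) :
  simple_graph e -> simple_graph (complement e).
Proof.
case=> eirr sym_e; split=> [x|x y]; first by rewrite /complement eqxx.
by rewrite /complement eq_sym sym_e.
Qed.

Lemma complementK (V : finType) (e : rel V) :
  irreflexive e -> complement (complement e) = e.
Proof.
move=> eirr; apply/funext => x; apply/funext => y; rewrite /complement.
by case: eqVneq => [->|_] /=; rewrite ?eirr // negbK.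
Qed.

Lemma degree_complement (V : finType) (e : rel V) x : irreflexive e ->
  (degree e x + degree (complement e) x).+1 = #|V|.
Proof.
move=> eirr; rewrite /degree /complement -cardsT (cardsD1 x setT) inE add1n; congr _.+1.
rewrite -cardsUI (_ : _ :&: _ = set0) ?cards0 ?addn0; last first.
  by apply/setP => y; rewrite !inE; case: (e x y); rewrite ?andbF.
apply: eq_card => y; rewrite !inE andbT eq_sym.
by case: eqVneq => [->|_] /=; rewrite ?eirr // orbN.
Qed.

Lemma num_edges_complement (V : finType) (e : rel V) : simple_graph e ->
  (2 * (num_edges e + num_edges (complement e)) + #|V| = #|V| ^ 2)%N.
Proof.
move=> se; rewrite mulnDr -!sum_degree //; last exact: simple_complement.
rewrite -big_split /= -sum1_card -big_split /= (eq_bigr (fun=> #|V|)).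
  by rewrite !sum_nat_const muln1.
by move=> x _; rewrite addn1 degree_complement //; case: se.
Qed.

Lemma simple_disjoint_union (I : finType) (V : I -> finType) (e : forall i, rel (V i)) :
  (forall i, simple_graph (e i)) -> simple_graph (disjoint_union e).
Proof.
move=> se; split=> [[i x]|[i x] [j y]]; rewrite /disjoint_union /=.
  by rewrite eqxx tagged_asE; case: (se i) => ->.
rewrite eq_sym; case: eqVneq => //= ij; case: _ / ij x => x.
by rewrite !tagged_asE; case: (se j).
Qed.

Lemma degree_disjoint_union (I : finType) (V : I -> finType) (e : forall i, rel (V i)) i
    (x : V i) : degree (disjoint_union e) (Tagged V x) = degree (e i) x.
Proof.
have inj : injective (fun y : V i => Tagged V y) by move=> y z; exact: eq_from_Tagged.
rewrite /degree -(card_imset _ inj); apply: eq_card => -[j y]; rewrite inE.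
rewrite /disjoint_union /=; case: eqVneq => [ij|nij] /=.
  by case: _ / ij y => y; rewrite tagged_asE mem_imset ?inE.
by symmetry; apply/imsetP => -[z _ [ij]]; rewrite ij eqxx in nij.
Qed.

Lemma num_edges_disjoint_union (I : finType) (V : I -> finType) (e : forall i, rel (V i)) :
  (forall i, simple_graph (e i)) ->
  num_edges (disjoint_union e) = (\sum_i num_edges (e i))%N.
Proof.
move=> se; suff: (2 * num_edges (disjoint_union e) = 2 * \sum_i num_edges (e i))%N by lia.
rewrite -sum_degree; last exact: simple_disjoint_union.
rewrite big_distrr /=; under [RHS]eq_bigr do rewrite -sum_degree //.
rewrite (sig_big_dep _ (fun _ => xpredT) (fun i x => degree (e i) x)) /=.
by apply: eq_bigr => -[i x] _; rewrite (degree_disjoint_union e x).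
Qed.

(** * Threshold graphs: closure properties and possible numbers of edges *)

Lemma threshold_simple (V : finType) (e : rel V) : threshold e -> simple_graph e.
Proof.
case=> ord [b [_ eE]]; split=> [x|x y]; first by rewrite eE eqxx.
by rewrite !eE eq_sym maxnC.
Qed.

Lemma threshold_complement (V : finType) (e : rel V) : threshold e -> threshold (complement e).
Proof.
case=> ord [b [inj eE]]; exists ord, (negb \o b); split=> // x y.
by rewrite /complement eE; case: eqVneq.
Qed.

Lemma threshold_relpre (V W : finType) (e : rel V) (f : W -> V) :
  injective f -> threshold e -> threshold (relpre f e).
Proof.
move=> finj [ord [b [inj eE]]]; exists (ord \o f), b; split; first exact: inj_comp.
by move=> x y; rewrite /= eE (inj_eq finj).
Qed.

Lemma threshold_add_isolated (V : finType) (e : rel V) : threshold e -> threshold (add_isolated e).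
Proof.
case=> ord [b [inj eE]]; pose M := (\max_v ord v)%N.
have ordM v : (ord v <= M)%N by exact: leq_bigmax.
(* The new node is inserted last, at [M.+1]; the cut-off [i <= M] makes it isolated whatever [b] is
   there. *)
exists (fun u => if u is inl v then ord v else M.+1), (fun i => b i && (i <= M)%N); split.
  move=> [x|[]] [y|[]] //=; first by move=> /inj ->.
  - by move=> h; have := ordM x; rewrite h ltnn.
  - by move=> h; have := ordM y; rewrite -h ltnn.
move=> [x|[]] [y|[]] /=; rewrite ?geq_max ?ltnn ?andbF //.
by rewrite !ordM !andbT eE (inj_eq (@inl_inj _ _)).
Qed.

Lemma exists_threshold (V : finType) m : (2 * m + #|V| <= #|V| ^ 2)%N ->
  exists2 T : rel V, threshold T & num_edges T = m.
Proof.
move: {2}#|V| (erefl #|V|) => n; elim: n V m => [|n IHn] V m cV; rewrite cV => mV.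
  have thr0 : threshold (fun _ _ : V => false).
    exists (fun v => nat_of_ord (enum_rank v)), (fun=> false); split=> [x y|x y].
      by move=> /val_inj/enum_rank_inj.
    by rewrite andbF.
  exists (fun _ _ => false) => //.
  have := sum_degree (threshold_simple thr0).
  rewrite big_pred0 => [|v]; last by have := fintype0 v cV.
  by lia.
(* Either [m] edges fit on [n] nodes, or the complementary count [m' = n (n + 1) / 2 - m] is below
   [n], hence at most [n (n - 1) / 2]. *)
wlog mn : m mV / (2 * m + n <= n ^ 2)%N.
  move=> small; case: (leqP (2 * m + n) (n ^ 2)) => [|mn]; first exact: small.
  have even : ~~ odd (n.+1 ^ 2 - n.+1).
    by rewrite -mulnn -{3}[n.+1]muln1 -mulnBr subn1 oddM /= andNb.
  pose m' := ((n.+1 ^ 2 - n.+1)./2 - m)%N.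
  have mm : (2 * (m + m') + n.+1 = n.+1 ^ 2)%N.
    rewrite /m'; have := odd_double_half (n.+1 ^ 2 - n.+1); rewrite (negPf even) -muln2; lia.
  have [| |T thT mT] := small m'; [nia|nia|].
  exists (complement T); first exact: threshold_complement.
  have := num_edges_complement (threshold_simple thT); rewrite cV mT; lia.
have [W cW] : exists W : finType, #|W| = n by exists 'I_n; rewrite card_ord.
have [|T thT mT] := IHn W m cW; first by rewrite cW.
have [|f bf] := @eq_card_bij V (W + unit)%type.
  by rewrite card_sum card_unit cW cV addn1.
have thT' := threshold_add_isolated thT.
exists (relpre f (add_isolated T)); first by apply: threshold_relpre => //; exact: bij_inj.
rewrite num_edges_relpre ?num_edges_add_isolated //; exact: threshold_simple.
Qed.

(** * Laplacian spectra *)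

(** Two enumerations differ by a permutation applied to rows and columns alike, so its sign occurs
    twice. This frees the Laplacian from the fixed enumeration [enum_val]. *)
Lemma char_poly_reindex (R : comNzRingType) (V : finType) (M : V -> V -> R)
    n m (g : 'I_n -> V) (h : 'I_m -> V) :
  bijective g -> bijective h ->
  char_poly (\matrix_(i, j) M (g i) (g j)) = char_poly (\matrix_(i, j) M (h i) (h j)).
Proof.
move=> bg bh; have enm : n = m.
  by rewrite -[n]card_ord -[m]card_ord (bij_eq_card bg) (bij_eq_card bh).
case: m / enm h bh => h [h' hK h'K].
have inj_s : injective (h' \o g) by apply: inj_comp (bij_inj bg); exact: can_inj h'K.
pose s := perm inj_s; rewrite /char_poly.
set A := char_poly_mx _; set B := char_poly_mx _.
have -> : A = row_perm s (col_perm s B).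
  by apply/matrixP => i j; rewrite !mxE !permE /= !h'K (inj_eq inj_s).
rewrite row_permE col_permE !det_mulmx !det_perm odd_permV.
by rewrite mulrC -mulrA -signr_addb addbb mulr1.
Qed.

(* Evaluate the determinant of the block matrix (1, - u; v, y) in two ways. *)
Lemma det_scalar_add_rank1 (R : comPzRingType) n (y : R) (u : 'rV[R]_n) (v : 'cV[R]_n) :
  y * \det (y%:M + v *m u) = (y + (u *m v) 0 0) * y ^+ n.
Proof.
pose M := block_mx 1%:M (- u) v y%:M : 'M_(1 + n).
have <- : \det M = \det (y%:M + v *m u).
  have -> : \det M = \det (M *m block_mx 1%:M u 0 1%:M).
    by rewrite det_mulmx det_ublock !det1 !mulr1.
  rewrite mulmx_block !mulmx1 !mul1mx !mulmx0 !addr0 subrr det_lblock det1 mul1r.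
  by rewrite addrC.
have <- : \det (M *m block_mx y%:M 0 (- v) 1%:M) = y * \det M.
  by rewrite det_mulmx det_lblock det1 mulr1 det_mx11 mxE eqxx mulr1n mulrC.
rewrite mulmx_block !mulmx1 !mul1mx !mulmx0 mulNmx mulmxN opprK !add0r.
rewrite mul_mx_scalar mulmxN mul_scalar_mx subrr det_ublock det_scalar.
by rewrite det_mx11 !mxE eqxx mulr1n.
Qed.

Section Spectra.
Variable R : realType.

Definition lap_entry (V : finType) (e : rel V) (x y : V) : R :=
  (if x == y then (degree e x)%:R else 0) - (e x y)%:R.

Lemma char_poly_laplacian (V : finType) (e : rel V) n (g : 'I_n -> V) :
  bijective g ->
  char_poly (laplacian R e) = char_poly (\matrix_(i, j) lap_entry e (g i) (g j)).
Proof.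
move=> bg; rewrite -(char_poly_reindex (lap_entry e) (enum_val_bij V) bg).
by congr char_poly; apply/matrixP => i j; rewrite !mxE /lap_entry (inj_eq enum_val_inj).
Qed.

Lemma char_poly_laplacian_iso (V W : finType) (e : rel V) (f : W -> V) :
  bijective f ->
  char_poly (laplacian R (relpre f e)) = char_poly (laplacian R e).
Proof.
move=> bf; have bg := bij_comp bf (enum_val_bij W).
rewrite (char_poly_laplacian e bg) (char_poly_laplacian _ (enum_val_bij W)).
congr char_poly; apply/matrixP => i j; rewrite !mxE /lap_entry /= (inj_eq (bij_inj bf)).
suff -> : degree (relpre f e) (enum_val i) = degree e (f (enum_val i)) by [].
rewrite /degree -[RHS](on_card_preimset (onW_bij _ bf)).
by apply: eq_card => y; rewrite !inE.
Qed.

(** Listing the nodes of [V] before those of [W] makes the Laplacian block diagonal. *)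
Lemma char_poly_laplacian_sum (V W : finType) (e : rel V) (f : rel W) :
  char_poly (laplacian R (sum_rel e f)) =
  char_poly (laplacian R e) * char_poly (laplacian R f).
Proof.
pose g (i : 'I_(#|V| + #|W|)) : V + W :=
  match split i with inl a => inl (enum_val a) | inr b => inr (enum_val b) end.
have bg : bijective g.
  exists (fun x => match x with inl a => lshift _ (enum_rank a)
                              | inr b => rshift _ (enum_rank b) end).
    by move=> i; rewrite /g -{2}(splitK i); case: (split i) => a; rewrite enum_valK.
  by case=> a; rewrite /g ?(unsplitK (inl _)) ?(unsplitK (inr _)) enum_rankK.
have gl a : g (lshift _ a) = inl (enum_val a) by rewrite /g (unsplitK (inl _)).
have gr a : g (rshift _ a) = inr (enum_val a) by rewrite /g (unsplitK (inr _)).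
rewrite (char_poly_laplacian _ bg) /char_poly -(det_ublock _ 0); congr determinant.
apply/matrixP => i j; rewrite -(splitK i) -(splitK j).
case: (split i) => a; case: (split j) => b /=;
rewrite ?block_mxEul ?block_mxEur ?block_mxEdl ?block_mxEdr !mxE ?gl ?gr /lap_entry /=
  ?degree_sum_inl ?degree_sum_inr ?eq_lrshift ?eq_rlshift ?subrr ?subr0 ?mulr0n //.
- by rewrite (inj_eq (@lshift_inj _ _)) (inj_eq (@inl_inj _ _)) (inj_eq enum_val_inj).
- by rewrite (inj_eq (@rshift_inj _ _)) (inj_eq (@inr_inj _ _)) (inj_eq enum_val_inj).
Qed.

(** * Characteristic polynomial of the complement *)

Lemma laplacian_complement (V : finType) (e : rel V) : irreflexive e ->
  laplacian R (complement e) = #|V|%:R%:M - const_mx 1 - laplacian R e.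
Proof.
move=> eirr; apply/matrixP => i j; rewrite !mxE /complement (inj_eq enum_val_inj).
case: (eqVneq i j) => [<-|nij] /=; rewrite ?mulr1n ?mulr0n ?eirr.
  by rewrite -(degree_complement (enum_val i) eirr) -natr1 natrD /=; ring.
by case: (e _ _) => /=; ring.
Qed.

Lemma laplacian_mul_ones (V : finType) (e : rel V) m :
  laplacian R e *m const_mx 1 = 0 :> 'M_(#|V|, m).
Proof.
apply/matrixP => i j; rewrite !mxE.
under eq_bigr => k _ do rewrite !mxE mulr1.
rewrite sumrB -big_mkcond /= (big_pred1 i) //.
apply/eqP; rewrite subr_eq0 /degree -sum1dep_card big_mkcond /=.
rewrite (reindex _ (onW_bij _ (enum_val_bij V))) natr_sum; apply/eqP.
by apply: eq_bigr => k _; case: (e _ _).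
Qed.

(** With [Y = X - n], the two characteristic polynomials become [det (Y + J + L)] and [det (Y + L)].
    As [L J = 0], the product [(Y + L) (Y + J)] is [Y (Y + J + L)], and [det (Y + J)] is known
    because [J] has rank one. The power [Y ^ n] is then cancelled. *)
Lemma char_poly_laplacian_complement (V : finType) (e : rel V) :
  irreflexive e ->
  ('X - #|V|%:R%:P) * char_poly (laplacian R (complement e)) =
  'X * ((-1) ^+ #|V| * (char_poly (laplacian R e) \Po (#|V|%:R%:P - 'X))).
Proof.
move=> eirr; set n := #|V|; set Y : {poly R} := _ - _.
pose L := map_mx polyC (laplacian R e); pose J : 'M[{poly R}]_n := const_mx 1.
have -> : (-1) ^+ n * (char_poly (laplacian R e) \Po (n%:R%:P - 'X)) = \det (Y%:M + L).
  rewrite -[char_poly _ \Po _]/(comp_poly _ _).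
  rewrite /char_poly -det_map_mx -detZ; congr determinant.
  apply/matrixP => i j; rewrite !mxE /= rmorphB rmorphMn /= comp_polyX comp_polyC /Y.
  by case: (i == j); rewrite ?mulr1n ?mulr0n; ring.
have -> : char_poly (laplacian R (complement e)) = \det (Y%:M + J + L).
  rewrite /char_poly laplacian_complement //; congr determinant.
  apply/matrixP => i j; rewrite !mxE /Y.
  by case: (i == j); rewrite ?mulr1n ?mulr0n !rmorphB /= ?polyC0 ?polyC1; ring.
have Yn0 : Y ^+ n != 0 by rewrite expf_neq0 // polyXsubC_eq0.
apply: (mulfI Yn0); rewrite mulrCA.
have LJ : L *m J = 0.
  have -> : J = map_mx polyC (const_mx 1) by apply/matrixP=> i j; rewrite !mxE polyC1.
  by rewrite /L -map_mxM laplacian_mul_ones map_mx0.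
have JE : J = (const_mx 1 : 'cV_n) *m (const_mx 1 : 'rV_n).
  by apply/matrixP=> i j; rewrite !mxE big_ord1 !mxE mulr1.
have -> : Y ^+ n * \det (Y%:M + J + L) = \det (Y%:M + L) * \det (Y%:M + J).
  rewrite -detZ -det_mulmx mulmxDl !mulmxDr LJ addr0.
  by rewrite !mul_scalar_mx mul_mx_scalar -!scalerDr.
rewrite mulrCA JE det_scalar_add_rank1 mxE.
under eq_bigr do rewrite !mxE mulr1.
by rewrite sumr_const card_ord /Y -[1 *+ n]/(n%:R) -(rmorph_nat polyC) /= subrK; ring.
Qed.

(* Eigenvalues are indexed by the nodes, in an arbitrary order, so that sums of
   eigenvalues are sums over sets of nodes. *)
Definition lap_roots (V : finType) (e : rel V) (lam : V -> R) : Prop :=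
  char_poly (laplacian R e) = \prod_v ('X - (lam v)%:P).

(** * Sorted spectra and sums over sets of nodes *)

Lemma lap_roots_spectrum (V : finType) (e : rel V) (lam : V -> R) :
  lap_roots e lam ->
  lap_spectrum e (sort >=%R [seq lam v | v <- enum V]).
Proof.
move=> elam; split; first by rewrite size_sort size_map cardE.
  by apply: sort_sorted => x y; exact: le_total.
rewrite elam (perm_big [seq lam v | v <- enum V]) ?perm_sort //=.
by rewrite big_map big_enum.
Qed.

(** A monic divisor of a product of linear factors is a product of some of them. Divisibility
    instead of equality is the form that suits a component of a disjoint union. *)
Lemma dvdp_lap_roots (V : finType) (e : rel V) (s : seq R) :
  char_poly (laplacian R e) %| \prod_(x <- s) ('X - x%:P) ->
  exists lam : V -> R, lap_roots e lam.
Proof.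
move=> /dvdp_prod_XsubC[b]; set t := mask b s => et.
have {et} et : char_poly (laplacian R e) = \prod_(x <- t) ('X - x%:P).
  by apply/eqP; rewrite -eqp_monic ?char_poly_monic ?monic_prod_XsubC.
have st : size t = #|V|.
  by apply: succn_inj; rewrite -(size_char_poly (laplacian R e)) et size_prod_XsubC.
exists (fun v => t`_(enum_rank v)); rewrite /lap_roots et.
rewrite [RHS](reindex _ (onW_bij _ (enum_val_bij V))) /=.
under [RHS]eq_bigr do rewrite enum_valK.
by rewrite (big_nth 0) st big_mkord.
Qed.

Lemma spectrum_lap_roots (V : finType) (e : rel V) (s : seq R) :
  lap_spectrum e s -> exists lam, lap_roots e lam.
Proof. by case=> _ _ es; apply: (@dvdp_lap_roots _ _ s); rewrite es dvdpp. Qed.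

Lemma lap_roots_nth (V : finType) (e : rel V) (s : seq R) (lam : V -> R) :
  lap_spectrum e s -> lap_roots e lam ->
  exists2 g : V -> 'I_#|V|, bijective g & forall v, lam v = s`_(g v).
Proof.
case=> ss _ es elam.
have /prod_XsubC_eq peq : \prod_(x <- [seq lam v | v <- enum V]) ('X - x%:P) =
    \prod_(x <- s) ('X - x%:P).
  by rewrite -es elam big_map big_enum.
move/eqP: ss => ss; case/tuple_permP: (peq : perm_eq _ (Tuple ss)) => p pE.
exists (fun v => p (enum_rank v)); first
  exact: bij_comp (injF_bij (@perm_inj _ p)) (enum_rank_bij V).
move=> v; have := congr1 (fun t => nth 0 t (enum_rank v)) pE.
rewrite (nth_map v) -?cardE // nth_enum_rank => ->.
by rewrite -[X in nth _ X _]/(val [tuple _ | i < _]) -tnth_nth tnth_mktuple (tnth_nth 0).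
Qed.

(** The set is the preimage of the first [k] indices. With [sum_le_top_sum], this makes the top sum
    the maximum over all [k]-sets. *)
Lemma top_sum_set (V : finType) (e : rel V) (s : seq R) (lam : V -> R) k :
  lap_spectrum e s -> lap_roots e lam -> (k <= #|V|)%N ->
  exists2 A : {set V}, #|A| = k & \sum_(v in A) lam v = top_sum s k.
Proof.
move=> es elam kV; have [g bg gE] := lap_roots_nth es elam.
exists [set v | g v < k]%N.
  rewrite -sum1dep_card -[RHS]card_ord -[RHS]sum1_card (big_ord_widen _ (fun=> 1%N) kV).
  by rewrite [RHS](reindex g (onW_bij _ bg)).
rewrite /top_sum (big_ord_widen _ (nth 0 s) kV) (reindex g (onW_bij _ bg)).
by apply: eq_big => v; rewrite ?inE.
Qed.

(* Compare the summands after subtracting the k-th largest value t from each. *)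
Lemma sum_le_top_sum (V : finType) (e : rel V) (s : seq R) (lam : V -> R) (A : {set V}) :
  lap_spectrum e s -> lap_roots e lam ->
  \sum_(v in A) lam v <= top_sum s #|A|.
Proof.
move=> es elam; have [g bg gE] := lap_roots_nth es elam; case: es => ss srt _.
have [->|/set0Pn[a aA]] := eqVneq A set0; first by rewrite cards0 /top_sum big_ord0 big_set0.
have kV : (#|A| <= #|V|)%N := max_card A.
have k0 : (0 < #|A|)%N by apply/card_gt0P; exists a.
set k := #|A| in kV k0 *; set t := s`_k.-1.
have s_ge i j : (i <= j < #|V|)%N -> s`_j <= s`_i.
  move=> /andP[ij jV]; apply: (sorted_leq_nth _ _ 0 srt) => //.
  - exact: ge_trans.
  - exact: ge_refl.
  - by rewrite inE ss; apply: leq_ltn_trans ij jV.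
  - by rewrite inE ss.
have -> : \sum_(v in A) lam v = k%:R * t + \sum_(v in A) (lam v - t).
  by rewrite sumrB sumr_const mulr_natl addrC subrK.
have -> : top_sum s k = k%:R * t + \sum_(i < k) (s`_i - t).
  by rewrite sumrB sumr_const card_ord mulr_natl addrC subrK.
rewrite lerD2l (big_ord_widen #|V| (fun i => s`_i - t) kV).
rewrite (reindex g (onW_bij _ bg)) /= big_mkcond [leRHS]big_mkcond /=.
apply: ler_sum => v _; rewrite gE; case: (ltnP (g v) k) => gk; last first.
  by case: ifP => // _; rewrite subr_le0 s_ge // ltn_ord andbT; lia.
by case: ifP => // _; rewrite subr_ge0 s_ge // -ltnS prednK // gk.
Qed.

(** * The trace and the eigenvalue 0 *)

Lemma trace_laplacian (V : finType) (e : rel V) : simple_graph e ->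
  \tr (laplacian R e) = (2 * num_edges e)%:R.
Proof.
move=> se; rewrite -sum_degree // natr_sum /mxtrace.
rewrite [RHS](reindex _ (onW_bij _ (enum_val_bij V))); apply: eq_bigr => i _.
by rewrite mxE eqxx; case: se => ->; rewrite subr0.
Qed.

Lemma sum_lap_roots (V : finType) (e : rel V) (lam : V -> R) :
  simple_graph e -> lap_roots e lam ->
  \sum_v lam v = (2 * num_edges e)%:R.
Proof.
(* The trace is read off the coefficient of degree [n - 1], so the empty graph is treated apart. *)
move=> se elam; have [V0|V0] := posnP #|V|.
  rewrite -sum_degree // !big_pred0 // => v; have := fintype0 v V0; by [].
rewrite -trace_laplacian //; apply: oppr_inj.
rewrite -char_poly_trace // elam.
have -> : \sum_v lam v = \sum_(p <- [seq lam v | v <- enum V]) p.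
  by rewrite big_map big_enum.
have -> : \prod_v ('X - (lam v)%:P) = \prod_(p <- [seq lam v | v <- enum V]) ('X - p%:P).
  by rewrite big_map big_enum.
have <- : size [seq lam v | v <- enum V] = #|V| by rewrite size_map cardE.
by rewrite coefPn_prod_XsubC // size_map -cardE -lt0n.
Qed.

(** The identity for complements, applied to [complement e] and evaluated at 0, reads
    [- n p(0) = 0], where [p] is the characteristic polynomial of [e]. *)
Lemma lap_roots_zero (V : finType) (e : rel V) (lam : V -> R) :
  (0 < #|V|)%N -> irreflexive e -> lap_roots e lam -> exists v, lam v = 0.
Proof.
move=> V0 eirr elam; have ceirr : irreflexive (complement e).
  by move=> x; rewrite /complement eqxx.
have := char_poly_laplacian_complement ceirr; rewrite complementK // elam.
move=> /(congr1 (horner^~ 0)) /eqP; rewrite !hornerE mulf_eq0 oppr_eq0 pnatr_eq0.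
rewrite (gtn_eqF V0) /= horner_prod => /prodf_eq0[v _].
by rewrite !hornerE oppr_eq0 => /eqP; exists v.
Qed.

(** Distributing the sign [(-1) ^ n] turns each substituted factor into [X - (n - lam v)]. The one
    for [v0] is [X - n], which cancels on both sides and leaves [X] in its place. *)
Lemma lap_roots_complement (V : finType) (e : rel V) (lam : V -> R) v0 :
  irreflexive e -> lap_roots e lam -> lam v0 = 0 ->
  lap_roots (complement e) (fun v => if v == v0 then 0 else #|V|%:R - lam v).
Proof.
move=> eirr elam lam0; have := char_poly_laplacian_complement eirr.
rewrite elam -[_ \Po _]/(comp_poly _ _) rmorph_prod /=.
have -> : (-1) ^+ #|V| = \prod_(v : V) (-1) :> {poly R} by rewrite prodr_const.
rewrite -big_split /= (eq_bigr (fun v => 'X - (#|V|%:R - lam v)%:P)); last first.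
  by move=> v _; rewrite comp_polyB comp_polyX comp_polyC polyCB; ring.
rewrite (bigD1 v0) //= lam0 subr0 mulrCA.
have /mulfI inj : 'X - #|V|%:R%:P != 0 :> {poly R} by rewrite polyXsubC_eq0.
move=> /inj; rewrite /lap_roots => ->; rewrite [RHS](bigD1 v0) //= eqxx subr0; congr (_ * _).
by apply: eq_bigr => v /negPf ->.
Qed.

(* Ranging over all sets A of size k instead of the k largest eigenvalues makes
   the bounds independent of any ordering. *)
Definition brouwer_bounded (V : finType) (e : rel V) (lam : V -> R) : Prop :=
  forall A : {set V}, let k : R := #|A|%:R in let m : R := (num_edges e)%:R in
    [/\ \sum_(v in A) lam v <= 2 * m,
        \sum_(v in A) lam v <= m + k * (k + 1) / 2 &
        \sum_(v in A) lam v <= k * #|V|%:R].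

(** The sum of [n - lam] over [B] is [b n - 2 m] plus the sum of [lam] over [C], where
    [c = n - 1 - b]. The bounds [2 m] and [c n] at [C] become [b n] and [2 m'] for the complement,
    while the middle bound keeps its form. Dropping [v0] from [A] only lowers the bounds. *)
Lemma brouwer_bounded_complement (V : finType) (e : rel V) (lam : V -> R) v0 :
  simple_graph e -> lap_roots e lam -> lam v0 = 0 -> brouwer_bounded e lam ->
  brouwer_bounded (complement e) (fun v => if v == v0 then 0 else #|V|%:R - lam v).
Proof.
move=> se elam lam0 Blam A /=.
have -> : \sum_(v in A) (if v == v0 then 0 else #|V|%:R - lam v) =
    \sum_(v in A :\ v0) (#|V|%:R - lam v).
  rewrite big_mkcond [RHS]big_mkcond; apply: eq_bigr => v _; rewrite !inE.
  by case: (v == v0) => //=; case: ifP.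
have lekA : (#|A :\ v0|%:R : R) <= #|A|%:R by rewrite ler_nat subset_leq_card // subD1set.
set B := A :\ v0 in lekA *; pose C := ~: B :\ v0.
have cC : (#|B| + #|C| + 1 = #|V|)%N.
  rewrite -(cardsC B) -addnA; congr addn; rewrite (cardsD1 v0 (~: B)) -/C !inE eqxx /=; lia.
have sB : \sum_(v in B) lam v + \sum_(v in C) lam v = 2 * (num_edges e)%:R.
  have := sum_lap_roots se elam; rewrite natrM => <-.
  rewrite [RHS](bigID (mem B)) /=; congr (_ + _).
  rewrite [RHS](bigD1 v0) /= ?lam0 ?add0r; last by rewrite !inE eqxx.
  by apply: eq_bigl => v; rewrite !inE andbC.
rewrite sumrB sumr_const -[_ *+ #|B|]mulr_natl.
have [] := Blam C.
have /(congr1 (fun n => n%:R : R)) := num_edges_complement se.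
move/(congr1 (fun n => n%:R : R)): cC; rewrite /= !natrD natrX.
have := ler0n R #|V|; have := ler0n R #|B|.
move: (#|V|%:R : R) (#|A|%:R : R) (#|B|%:R : R) (#|C|%:R : R) lekA => n a b c ab b0 n0 cE.
have -> : c = n - 1 - b by lra.
by move=> mE h1 h2 h3; split; nra.
Qed.

(** All roots sum to [2 m], and those other than [lam v] to at most [2 m]. *)
Lemma brouwer_bounded_ge0 (V : finType) (e : rel V) (lam : V -> R) v :
  simple_graph e -> lap_roots e lam -> brouwer_bounded e lam -> 0 <= lam v.
Proof.
move=> se elam /(_ [set~ v])[+ _ _].
have := sum_lap_roots se elam; rewrite natrM => <-.
rewrite [leRHS](bigD1 v) //= (eq_bigl (fun i => i != v)); last by move=> i; rewrite !inE.
by rewrite lerDr.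
Qed.

(** * Roots and bounds under isomorphism, disjoint union and isolated nodes *)

Lemma lap_roots_relpre (V W : finType) (e : rel V) (f : W -> V) (lam : V -> R) :
  bijective f -> lap_roots e lam -> lap_roots (relpre f e) (lam \o f).
Proof.
move=> bf elam; rewrite /lap_roots char_poly_laplacian_iso // elam.
by rewrite (reindex f (onW_bij _ bf)).
Qed.

Lemma brouwer_bounded_relpre (V W : finType) (e : rel V) (f : W -> V) (lam : V -> R) :
  simple_graph e -> bijective f ->
  brouwer_bounded e lam -> brouwer_bounded (relpre f e) (lam \o f).
Proof.
move=> se bf Blam A /=; rewrite num_edges_relpre // (bij_eq_card bf).
have := Blam (f @: A) => /=; rewrite (card_imset _ (bij_inj bf)).
by rewrite big_imset //= => x y _ _; exact: bij_inj.
Qed.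

Lemma char_poly_disjoint_union (I : finType) (V : I -> finType) (e : forall i, rel (V i)) :
  char_poly (laplacian R (disjoint_union e)) = \prod_i char_poly (laplacian R (e i)).
Proof.
move: {2}#|I| (erefl #|I|) => n; elim: n I V e => [|n IHn] I V e cI.
  have I0 (i : I) : False by have := fintype0 i cI.
  rewrite big_pred0 => [|i]; last by case: (I0 i).
  rewrite /char_poly; move: (char_poly_mx _).
  rewrite (_ : #|{: {i : I & V i}}| = 0%N) => [A|]; first exact: det_mx00.
  by apply: eq_card0 => -[i]; case: (I0 i).
(* One component [i0] is split off; the others form a disjoint union indexed by [J]. *)
have /card_gt0P[i0 _] : (0 < #|I|)%N by rewrite cI.
pose J : finType := {i : I | i != i0}.
pose f (u : V i0 + {j : J & V (val j)}) : {i : I & V i} :=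
  match u with inl x => Tagged V x | inr w => Tagged V (tagged w) end.
have bf : bijective f.
  apply: inj_surj_bij => [[x|[j x]] [y|[k y]] /=|[i x]].
  - by move=> h; rewrite (eq_from_Tagged h).
  - by case=> ij; case/eqP: (valP k).
  - by case=> ij; case/eqP: (valP j).
  - move=> fxy; have /val_inj jk : val j = val k by case: fxy.
    by case: _ / jk y fxy => y h; rewrite (eq_from_Tagged h).
  - have [ii0|ni] := eqVneq i i0; first by case: _ / (esym ii0) x => x; exists (inl x).
    by exists (inr (Tagged (fun j : J => V (val j)) (x : V (val (exist _ i ni : J))))).
rewrite -(char_poly_laplacian_iso _ bf).
have -> : (relpre f (disjoint_union e) : rel _) =
    sum_rel (e i0) (disjoint_union (fun j : J => e (val j))).
  apply/funext => -[x|[j x]]; apply/funext => -[y|[k y]]; rewrite /disjoint_union /=.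
  - by rewrite eqxx tagged_asE.
  - by rewrite eq_sym (negPf (valP k)).
  - by rewrite (negPf (valP j)).
  - rewrite (inj_eq val_inj); case: eqVneq => //= jk; case: _ / jk y => y.
    by rewrite !tagged_asE.
rewrite char_poly_laplacian_sum IHn; last first.
  by rewrite card_sig; have := cardC1 i0; rewrite cI /= => <-; apply: eq_card.
rewrite [RHS](bigD1 i0) //=; congr (_ * _).
rewrite [RHS](reindex_omap (val : J -> I) (insub : I -> option J)) /= => [|i ni].
  by apply: eq_bigl => j; rewrite valK (valP j) eqxx.
by rewrite insubT.
Qed.

Lemma lap_roots_disjoint_union (I : finType) (V : I -> finType) (e : forall i, rel (V i))
    (lam : forall i, V i -> R) :
  (forall i, lap_roots (e i) (lam i)) ->
  lap_roots (disjoint_union e) (fun u => lam (tag u) (tagged u)).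
Proof.
move=> elam; rewrite /lap_roots char_poly_disjoint_union.
under eq_bigr do rewrite elam.
by rewrite (sig_big_dep _ (fun _ => xpredT) (fun i x => 'X - (lam i x)%:P)).
Qed.

Lemma brouwer_bounded_disjoint_union (I : finType) (V : I -> finType)
    (e : forall i, rel (V i)) (lam : forall i, V i -> R) :
  (forall i, simple_graph (e i)) ->
  (forall i, brouwer_bounded (e i) (lam i)) ->
  brouwer_bounded (disjoint_union e) (fun u => lam (tag u) (tagged u)).
Proof.
move=> se Blam A k m; pose A_ i : {set V i} := [set x | Tagged V x \in A].
have sA (T : nmodType) (F : forall i, V i -> T) :
    \sum_(u in A) F (tag u) (tagged u) = \sum_i \sum_(x in A_ i) F i x.
  rewrite (sig_big_dep _ (fun i => mem (A_ i))) /=.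
  by apply: eq_bigl => -[i x]; rewrite inE.
have kE : k = \sum_i #|A_ i|%:R.
  rewrite /k -sum1_card natr_sum (sA R (fun _ _ => 1%:R)); apply: eq_bigr => i _.
  by rewrite -natr_sum sum1_card.
have mE : m = \sum_i (num_edges (e i))%:R by rewrite /m num_edges_disjoint_union // natr_sum.
have Ak i : #|A_ i|%:R <= k.
  by rewrite kE (bigD1 i) //= lerDl sumr_ge0.
rewrite sA; split.
- by rewrite mE mulr_sumr; apply: ler_sum => i _; case: (Blam i (A_ i)).
(* Each [k_i <= k], so [k_i (k_i + 1) / 2 <= k_i (k + 1) / 2], and the right-hand sides add up to
   [k (k + 1) / 2]. *)
- apply: (@le_trans _ _ (m + \sum_i #|A_ i|%:R * ((k + 1) / 2))); last first.
    by rewrite -mulr_suml -kE mulrA.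
  rewrite mE -big_split /=; apply: ler_sum => i _.
  case: (Blam i (A_ i)) => _ h _; apply: le_trans h _; rewrite lerD2l -mulrA ler_wpM2l //.
  by rewrite ler_pM2r ?lerD2r // invr_gt0.
- rewrite kE mulr_suml; apply: ler_sum => i _.
  case: (Blam i (A_ i)) => _ _ h; apply: le_trans h _; rewrite ler_wpM2l // ler_nat.
  by apply: (@leq_card _ _ (fun x => Tagged V x)) => y z; exact: eq_from_Tagged.
Qed.

Definition extend_zero (V : finType) (lam : V -> R) (u : V + unit) : R :=
  if u is inl v then lam v else 0.

Lemma lap_roots_add_isolated (V : finType) (e : rel V) (lam : V -> R) :
  lap_roots e lam -> lap_roots (add_isolated e) (extend_zero lam).
Proof.
move=> elam; rewrite /lap_roots char_poly_laplacian_sum elam big_sumType /=; congr (_ * _).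
rewrite (big_pred1 tt) => [|[]//].
have bg : bijective ((fun=> tt) : 'I_1 -> unit).
  by exists (fun=> ord0) => [i|[]] //; rewrite [i]ord1.
rewrite (char_poly_laplacian _ bg) /char_poly det_mx11 !mxE /lap_entry /=.
by rewrite /degree eq_card0 ?subr0 // => y; rewrite inE.
Qed.

Lemma brouwer_bounded_add_isolated (V : finType) (e : rel V) (lam : V -> R) :
  simple_graph e -> brouwer_bounded e lam ->
  brouwer_bounded (add_isolated e) (extend_zero lam).
Proof.
move=> se Blam A /=; pose B : {set V} := inl @^-1: A.
have BA : (#|B|%:R : R) <= #|A|%:R.
  rewrite ler_nat -(card_imset _ (@inl_inj V unit)); apply: subset_leq_card.
  by apply/subsetP => _ /imsetP[v + ->]; rewrite inE.
have B0 := ler0n R #|B|.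
rewrite num_edges_add_isolated // card_sum card_unit natrD.
rewrite big_mkcond big_sumType /= -big_mkcond /= [X in _ + X]big1 ?addr0; last first.
  by move=> x _; case: ifP.
rewrite (eq_bigl (mem B)); last by move=> v; rewrite /= inE.
have n0 := ler0n R #|V|.
by case: (Blam B) => h1 h2 h3; split; nra.
Qed.

(** * Threshold graphs *)

Lemma threshold_brouwer_bounded (V : finType) (e : rel V) : threshold e ->
  exists2 lam : V -> R, lap_roots e lam & brouwer_bounded e lam.
Proof.
move: {2}#|V| (erefl #|V|) => n; elim: n V e => [|n IHn] V e cV the.
  exists (fun=> 0) => [|A /=].
    rewrite /lap_roots big_pred0 => [|v]; last by have := fintype0 v cV.
    by rewrite /char_poly; move: (char_poly_mx _); rewrite cV => M; exact: det_mx00.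
  by rewrite big1 //; split; rewrite ?addr_ge0 ?mulr_ge0 ?invr_ge0 ?addr_ge0.
have V0 : (0 < #|V|)%N by rewrite cV.
have [ord [b [inj eE]]] := the; have /card_gt0P[x1 _] := V0.
(* [x0] is the node inserted last, so its adjacencies are all decided by [b (ord x0)]. *)
pose x0 := [arg max_(x > x1) ord x].
have ord0 y : (ord y <= ord x0)%N.
  by rewrite /x0; case: arg_maxnP => // x _; apply.
(* If [x0] is dominating, it is isolated in the complement, which has the same insertion order and
   the negated choices. *)
wlog b0 : e b the eE / b (ord x0) = false.
  move=> iso; case b0 : (b (ord x0)); last exact: iso b0.
  have se := threshold_simple the; have sce := simple_complement se.
  have [|//||lam clam Blam] := iso (complement e) (negb \o b).
  - exact: threshold_complement.
  - by move=> x y; rewrite /complement eE; case: eqVneq.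
  - by rewrite /= b0.
  have [v0 lam0] := lap_roots_zero V0 sce.1 clam.
  eexists; rewrite -(complementK se.1).
    exact: (lap_roots_complement sce.1 clam lam0).
  exact: brouwer_bounded_complement.
pose W : finType := {x | x != x0}.
pose f (u : W + unit) : V := if u is inl w then val w else x0.
have [h fK hK] : bijective f.
  apply: inj_surj_bij => [[x|[]] [y|[]] //= fxy|x].
  - by rewrite (val_inj fxy).
  - by have := valP x; rewrite /= fxy eqxx.
  - by have := valP y; rewrite /= -fxy eqxx.
  - have [->|nx] := eqVneq x x0; first by exists (inr tt).
    by exists (inl (exist _ x nx : W)).
have eh : e = relpre h (add_isolated (relpre val e : rel W)).
  apply/funext => x; apply/funext => y; rewrite -[x]hK -[y]hK /= !fK.
  case: (h x) => [u|[]]; case: (h y) => [w|[]] //=; rewrite eE.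
  - by rewrite (maxn_idPr (ord0 _)) b0 andbF.
  - by rewrite (maxn_idPl (ord0 _)) b0 andbF.
  - by rewrite eqxx.
have [||lam elam Blam] := IHn W (relpre val e).
- by rewrite card_sig; have := cardC1 x0; rewrite cV /= => <-; apply: eq_card.
- by apply: threshold_relpre => //; exact: val_inj.
have sW : simple_graph (relpre val e : rel W) by apply: simple_relpre; exact: threshold_simple.
have bh : bijective h by exists f.
exists (extend_zero lam \o h); rewrite eh.
  exact/lap_roots_relpre/lap_roots_add_isolated.
apply: brouwer_bounded_relpre => //; first exact: simple_add_isolated.
exact: brouwer_bounded_add_isolated.
Qed.

(* Only one of the three bounds of [brouwer_bounded] has to be attained: the
   smallest one. *)
Definition extremal (V : finType) (m k : nat) : Prop :=
  exists (T : rel V) (lam : V -> R) (A : {set V}),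
    [/\ threshold T, num_edges T = m, lap_roots T lam, #|A| = k &
      [\/ 2 * m%:R <= \sum_(v in A) lam v,
          m%:R + k%:R * (k%:R + 1) / 2 <= \sum_(v in A) lam v |
          k%:R * #|V|%:R <= \sum_(v in A) lam v]].

(** The bounded family [mu] may list the roots in another order than [lam], so the values are
    compared as roots of the characteristic polynomial. *)
Lemma threshold_lap_roots_ge0 (V : finType) (T : rel V) (lam : V -> R) v :
  threshold T -> lap_roots T lam -> 0 <= lam v.
Proof.
move=> thT Tlam; have [mu Tmu Bmu] := threshold_brouwer_bounded thT.
have : root (char_poly (laplacian R T)) (lam v).
  by rewrite Tlam /root horner_prod (bigD1 v) //= !hornerE subrr mul0r.
rewrite Tmu /root horner_prod => /prodf_eq0[w _]; rewrite !hornerE subr_eq0 => /eqP->.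
exact: brouwer_bounded_ge0 (threshold_simple thT) Tmu Bmu.
Qed.

(* A root 0 at v0 inside A can be exchanged for a root outside A, since all
   roots are nonnegative. *)
Lemma extremal_complement (V : finType) (m m' k k' : nat) :
  (2 * (m + m') + #|V| = #|V| ^ 2)%N -> (k + k' + 1 = #|V|)%N ->
  extremal V m k -> extremal V m' k'.
Proof.
move=> mm kk [T [lam [A [thT mT Tlam cA ext]]]].
have sT := threshold_simple thT.
have V0 : (0 < #|V|)%N by lia.
have [v0 lam0] := lap_roots_zero V0 sT.1 Tlam.
wlog v0A : A cA ext / v0 \notin A.
  move=> swap; have [v0A|] := boolP (v0 \in A); last exact: swap.
  have /card_gt0P[v] : (0 < #|~: A|)%N by have := cardsC A; lia.
  rewrite inE => vA.
  have vNA : v \notin A :\ v0 by rewrite !inE negb_and vA orbT.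
  have vv0 : v0 != v by apply: contraNneq vA => <-.
  apply: (swap (v |: A :\ v0)); last by rewrite !inE eqxx (negPf vv0).
    by rewrite cardsU1 vNA -cA (cardsD1 v0 A) v0A.
  have le : \sum_(w in A) lam w <= \sum_(w in v |: A :\ v0) lam w.
    rewrite big_setU1 //= (big_setD1 v0) //= lerD2r lam0.
    exact: threshold_lap_roots_ge0 thT Tlam.
  by case: ext => h; [constructor 1|constructor 2|constructor 3]; apply: le_trans h le.
exists (complement T), (fun v => if v == v0 then 0 else #|V|%:R - lam v), (~: A :\ v0).
have cB : #|~: A :\ v0| = k'.
  by have := cardsC A; rewrite (cardsD1 v0 (~: A)) inE v0A; lia.
split=> //; first exact: threshold_complement.
- by have := num_edges_complement sT; rewrite mT; lia.
- exact: lap_roots_complement sT.1 Tlam lam0.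
have -> : \sum_(v in ~: A :\ v0) (if v == v0 then 0 else #|V|%:R - lam v) =
    k'%:R * #|V|%:R - 2 * m%:R + \sum_(v in A) lam v.
  rewrite (eq_bigr (fun v => #|V|%:R - lam v)); last by move=> v; rewrite !inE => /andP[/negPf->].
  rewrite sumrB sumr_const cB -[_ *+ k']mulr_natl -addrA; congr (_ + _).
  have := sum_lap_roots sT Tlam; rewrite natrM mT => <-.
  rewrite [in RHS](bigID (mem A)) /= addrC opprD addrA subrr sub0r; congr (- _).
  rewrite [RHS](bigD1 v0) //= lam0 add0r; apply: eq_bigl => v.
  by rewrite !inE andbC.
have mmR : 2 * (m%:R + m'%:R) + #|V|%:R = #|V|%:R ^+ 2 :> R.
  by rewrite -natrD -natrM -natrD mm natrX.
have kR : k%:R = #|V|%:R - 1 - k'%:R :> R by rewrite -kk !natrD; ring.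
rewrite kR in ext; move: (#|V|%:R : R) mmR ext => n mmR.
(* The bounds [2 m] and [k n] trade places under complement; the middle one is kept. *)
by case=> h; [constructor 3|constructor 2|constructor 1]; nra.
Qed.

(** Of the three bounds only [k n] changes with the new node. The hypothesis says
    [m + k (k + 1) / 2 <= k |W|], so if [k |W|] was attained, then the middle bound is attained
    too. *)
Lemma extremal_add_isolated (V W : finType) (m k : nat) :
  #|V| = #|W|.+1 -> (2 * m + k * k.+1 <= 2 * (k * #|W|))%N ->
  extremal W m k -> extremal V m k.
Proof.
move=> cV mk [T [lam [A [thT mT Tlam cA ext]]]].
have sT := threshold_simple thT.
have [|f bf] := @eq_card_bij V (W + unit)%type.
  by rewrite card_sum card_unit cV addn1.
have [h fK hK] := bf.
have bh : bijective h by exists f.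
exists (relpre f (add_isolated T)), (extend_zero lam \o f), (h @: (inl @: A)).
have thT' := threshold_add_isolated thT.
split.
- by apply: threshold_relpre => //; exact: bij_inj.
- by rewrite num_edges_relpre ?num_edges_add_isolated //; exact: threshold_simple.
- exact/lap_roots_relpre/lap_roots_add_isolated.
- by rewrite !card_imset //; [exact: inl_inj|exact: bij_inj].
have -> : \sum_(v in h @: (inl @: A)) (extend_zero lam \o f) v = \sum_(v in A) lam v.
  rewrite big_imset => [|x y _ _]; last exact: bij_inj.
  rewrite big_imset => [|x y _ _]; last exact: inl_inj.
  by apply: eq_bigr => v _; rewrite /= hK.
have mkR : 2 * m%:R + k%:R * (k%:R + 1) <= 2 * (k%:R * #|W|%:R) :> R.
  by rewrite natr1 -!natrM -natrD ler_nat.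
by case: ext => ext; [constructor 1|constructor 2|constructor 2] => //; lra.
Qed.

Lemma extremal_exists (V : finType) (m k : nat) :
  (2 * m + #|V| <= #|V| ^ 2)%N -> (k <= #|V|)%N -> extremal V m k.
Proof.
move: {2}#|V| (erefl #|V|) => n; elim: n V m k => [|n IHn] V m k cV mV kV.
all: have [T thT mT] := exists_threshold mV; have [lam Tlam _] := threshold_brouwer_bounded thT.
all: have sT := threshold_simple thT; have := sum_lap_roots sT Tlam; rewrite natrM mT => sumV.
  exists T, lam, set0; split=> //; first by rewrite cards0; lia.
  by constructor 3; rewrite cV mulr0 big_set0.
have [k0|k0] := posnP k.
  exists T, lam, set0; split=> //; first by rewrite cards0 k0.
  by constructor 3; rewrite k0 mul0r big_set0.
have [kn|kn] := eqVneq k n.+1.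
  exists T, lam, setT; split=> //; first by rewrite cardsT; lia.
  by constructor 1; rewrite -sumV [leRHS](eq_bigl xpredT) // => v; rewrite inE.
have [v0 lam0] : exists v, lam v = 0 by apply: (lap_roots_zero _ sT.1 Tlam); rewrite cV.
(* Leaving out one zero root costs nothing: the other [n] roots still sum to [2 m]. *)
have [kn'|kn'] := eqVneq k n.
  exists T, lam, [set~ v0]; split=> //; first by rewrite cardsC1 cV kn'.
  constructor 1; rewrite -sumV (bigD1 v0) //= lam0 add0r.
  by rewrite [leRHS](eq_bigl (fun v => v != v0)) // => v; rewrite !inE.
have [W cW] : exists W : finType, #|W| = n by exists 'I_n; rewrite card_ord.
have small m1 k1 : (0 < k1 < n)%N -> (2 * m1 + k1 * k1.+1 <= 2 * (k1 * n))%N -> extremal V m1 k1.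
  move=> k1n mk; apply: (extremal_add_isolated (W := W)); rewrite ?cW //.
  (* [m1] edges fit on [n] nodes because [n (n - 1) - k1 (2 n - k1 - 1) = (n - k1) (n - k1 - 1) >=
     0]. *)
  by apply: IHn; rewrite ?cW //; nia.
have [mk|mk] := leqP (2 * m + k * k.+1) (2 * (k * n)); first by apply: small => //; lia.
pose m' := num_edges (complement T).
have mm : (2 * (m' + m) + #|V| = #|V| ^ 2)%N by rewrite -(num_edges_complement sT) mT (addnC m).
have [k' kE] : exists k', (k' + k + 1 = #|V|)%N by exists (#|V| - k - 1)%N; lia.
apply: (extremal_complement mm kE); apply: small; first lia.
rewrite cV in mm kE; have nE : n = (k' + k)%N by lia.
(* As [k (k + 1)] is even, the failed criterion can be halved to a strict inequality of integers;
   the unit gained is the [+ 1] in [pos]. *)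
have [h hE] : exists h, (k * k.+1 = 2 * h)%N.
  exists (k * k.+1)./2; rewrite mul2n -[LHS]odd_double_half oddM /=.
  by case: (odd k).
have mh : (k * (k' + k) < m + h)%N by rewrite nE in mk; lia.
(* This is [(k - 1) (k' - 1) >= 0], to which the criterion for [(m', k')] reduces. *)
have pos : (k + k' <= k * k' + 1)%N.
  have : (0 < k')%N by lia.
  by move: k0; clear; case: k => // k _; case: k' => // k' _; lia.
rewrite nE -mulnn in mm *; clear -mm mh hE pos; lia.
Qed.

(** * Equivalence of domination with the three bounds, and its consequences *)

Lemma spec_thr_dominated_brouwer (V : finType) (e : rel V) (lam : V -> R) :
  spec_thr_dominated R e -> lap_roots e lam -> brouwer_bounded e lam.
Proof.
(* Domination speaks only of [k >= 1], so the empty set is treated apart. *)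
move=> dom elam A; have [->|A0] := eqVneq A set0.
  by rewrite /= cards0 !big_set0 !mul0r !addr0; split; rewrite ?mulr_ge0.
have es := lap_roots_spectrum elam.
have [|T [thT mT [sT [Ts le]]]] := dom #|A| _ _ es.
  by rewrite max_card card_gt0 A0.
(* The bounds depend only on the numbers of nodes and edges and on [k], which [T] shares with
   [e]. *)
have [mu Tmu Bmu] := threshold_brouwer_bounded thT.
have [B cB sB] := top_sum_set Ts Tmu (max_card A).
have := Bmu B; rewrite cB sB mT /= => -[h1 h2 h3].
have {}le := le_trans (sum_le_top_sum A es elam) le.
by split; apply: le_trans le _.
Qed.

Lemma brouwer_spec_thr_dominated (V : finType) (e : rel V) :
  simple_graph e ->
  (forall lam : V -> R, lap_roots e lam -> brouwer_bounded e lam) ->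
  spec_thr_dominated R e.
Proof.
move=> se Be k /andP[_ kV] s es.
have [lam elam] := spectrum_lap_roots es.
have [B cB sB] := top_sum_set es elam kV.
have mV : (2 * num_edges e + #|V| <= #|V| ^ 2)%N.
  by have := num_edges_complement se; lia.
(* [T] attains one of the three bounds at [k], and the top sum of [e] lies below each of them. *)
have [T [mu [A [thT mT Tmu cA ext]]]] := extremal_exists mV kV.
exists T; split=> //; exists (sort >=%R [seq mu v | v <- enum V]).
have Ts := lap_roots_spectrum Tmu; split=> //.
rewrite -cA; apply: le_trans (sum_le_top_sum A Ts Tmu); rewrite cA -sB.
have := Be lam elam B; rewrite cB => -[h1 h2 h3].
by case: ext => h; apply: le_trans h.
Qed.

(** A sum of [lam] is at most a top sum, and that top sum is also a sum of [mu] over a set of the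
    same size. *)
Lemma brouwer_bounded_eq_roots (V : finType) (e : rel V) (lam mu : V -> R) :
  lap_roots e lam -> lap_roots e mu -> brouwer_bounded e mu -> brouwer_bounded e lam.
Proof.
move=> elam emu Bmu A; have es := lap_roots_spectrum elam.
have le := sum_le_top_sum A es elam.
have [B cB sB] := top_sum_set es emu (max_card A).
have := Bmu B; rewrite cB sB /= => -[h1 h2 h3].
by split; apply: le_trans le _.
Qed.

Lemma spec_thr_dominated_disjoint_union (I : finType) (V : I -> finType)
    (e : forall i, rel (V i)) :
  (forall i, simple_graph (e i)) -> (forall i, spec_thr_dominated R (e i)) ->
  spec_thr_dominated R (disjoint_union e).
Proof.
move=> se dom; apply: brouwer_spec_thr_dominated; first exact: simple_disjoint_union.
move=> lam elam.
(* Roots are given for the union only; the characteristic polynomial of each component divides that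
   of the union and so splits as well. *)
have split i : exists mu : V i -> R, lap_roots (e i) mu.
  apply: (@dvdp_lap_roots _ _ [seq lam u | u <- enum {: {i : I & V i}}]).
  rewrite big_map big_enum /= -elam char_poly_disjoint_union (bigD1 i) //=.
  exact: dvdp_mulIl.
pose mu i := projT1 (cid (split i)).
have emu i : lap_roots (e i) (mu i) by exact: projT2 (cid (split i)).
apply: brouwer_bounded_eq_roots elam (lap_roots_disjoint_union emu) _.
apply: brouwer_bounded_disjoint_union => // i.
exact: spec_thr_dominated_brouwer.
Qed.

Lemma spec_thr_dominated_complement (V : finType) (e : rel V) :
  simple_graph e -> spec_thr_dominated R e -> spec_thr_dominated R (complement e).
Proof.
move=> se dom; have sce := simple_complement se.
apply: brouwer_spec_thr_dominated => // lam celam A.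
have [A0|] := eqVneq A set0.
  by rewrite /= A0 cards0 !big_set0 !mul0r !addr0; split; rewrite ?mulr_ge0.
move=> /set0Pn[v _]; have V0 : (0 < #|V|)%N by apply/card_gt0P; exists v.
have [v0 lam0] := lap_roots_zero V0 sce.1 celam.
(* Complementing the given roots yields roots of [e], to which domination applies. Complementing
   these again gives a bounded family of roots for the complement, perhaps in another order than
   [lam]. *)
have := lap_roots_complement sce.1 celam lam0; rewrite (complementK se.1) => emu.
have [v1 mu0] := lap_roots_zero V0 se.1 emu.
apply: (brouwer_bounded_eq_roots celam (lap_roots_complement se.1 emu mu0)).
apply: brouwer_bounded_complement => //.
exact: spec_thr_dominated_brouwer.
Qed.

End Spectra.

Theorem theorem3 (R : realType) :
  (forall (I : finType) (V : I -> finType) (e : forall i, rel (V i)),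
      (forall i, simple_graph (e i)) ->
      (forall i, @spec_thr_dominated R _ (e i)) ->
      @spec_thr_dominated R _ (disjoint_union e))
  /\
  (forall (V : finType) (e : rel V),
      simple_graph e -> @spec_thr_dominated R V e ->
      @spec_thr_dominated R V (complement e)).
Proof.
split=> [I V e|V e]; first exact: spec_thr_dominated_disjoint_union.
exact: spec_thr_dominated_complement.
Qed.
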